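(* Let $(X,\mathcal{A})$ be a measurable space, let $\mu\colon\mathcal{A}\to[0,\infty]$ be a nonadditive measure, and let $0<p<\infty$ and $0<q<\infty$. Assume that $\mu$ is monotone autocontinuous from below and has property (C) and the pseudometric generating property (p.g.p.). Then $\mathcal{L}^{p,q}(\mu)$ and $L^{p,q}(\mu)$ are quasi-complete.
   Context: $X$ is a nonempty set and $\mathcal{A}$ is a $\sigma$-field of subsets of $X$. A nonadditive measure is a set function $\mu\colon\mathcal{A}\to[0,\infty]$ with $\mu(\emptyset)=0$ and $\mu(A)\le\mu(B)$ whenever $A,B\in\mathcal{A}$, $A\subset B$. $\mathcal{F}_0(X)$ is the real linear space of all $\mathcal{A}$-measurable functions $X\to\mathbb{R}$. Monotone autocontinuous from below: $\mu(A\setminus B_n)\to\mu(A)$ whenever $A,B_n\in\mathcal{A}$, $\{B_n\}_{n\in\mathbb{N}}$ is nonincreasing, and $\mu(B_n)\to 0$. (This implies null-additivity: $\mu(A\cup B)=\mu(A)$ whenever $\mu(B)=0$.) Property (C): for any sequence $\{E_n\}_{n\in\mathbb{N}}\subset\mathcal{A}$, if $\sup_{l\in\mathbb{N}}\mu\left(\bigcup_{n=k}^{k+l}E_n\right)\to 0$ as $k\to\infty$, then $\mu\left(\bigcup_{n=k}^\infty E_n\right)\to 0$ as $k\to\infty$. (p.g.p.): $\mu(A_n\cup B_n)\to 0$ whenever $A_n,B_n\in\mathcal{A}$ and $\max\{\mu(A_n),\mu(B_n)\}\to 0$. Choquet integral: $\mathrm{Ch}(\nu,g):=\int_0^\infty\nu(\{g>t\})\,dt\in[0,\infty]$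 for a nonadditive measure $\nu$ and measurable $g\colon X\to[0,\infty)$. With $\mu^{q/p}(A):=\mu(A)^{q/p}$, define for $f\in\mathcal{F}_0(X)$ $$\|f\|_{p,q}:=\left(\frac{p}{q}\right)^{1/q}\mathrm{Ch}(\mu^{q/p},|f|^q)^{1/q}\in[0,\infty],$$ and $\mathcal{L}^{p,q}(\mu):=\{f\in\mathcal{F}_0(X):\|f\|_{p,q}<\infty\}$ (in general not a linear space; $\|\cdot\|_{p,q}$ is nevertheless defined on all of $\mathcal{F}_0(X)$). $f\sim g$ iff $\mu(\{|f-g|>c\})=0$ for every $c>0$; this is an equivalence relation on $\mathcal{F}_0(X)$ here; $[f]$ is the class of $f$, with $[f]+[g]:=[f+g]$, $c[f]:=[cf]$. $L^{p,q}(\mu):=\{[f]: f\in\mathcal{L}^{p,q}(\mu)\}$ and $\|[f]\|_{p,q}:=\|f\|_{p,q}$ (well-defined since $\mu$ is null-additive). A sequence $\{x_n\}$ converges to $x$ if $\|x_n-x\|_{p,q}\to 0$; it is Cauchy if for any $\varepsilon>0$ there is $n_0$ with $\|x_m-x_n\|_{p,q}<\varepsilon$ for all $m,n\ge n_0$; it is bounded if $\sup_n\|x_n\|_{p,q}<\infty$. Quasi-complete means that every bounded Cauchy sequence in the space converges to an element of the space. *)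

(* Defs.v *)
From HB Require Import structures.
From mathcomp Require Import all_boot all_order all_algebra generic_quotient.
From mathcomp Require Import all_classical all_reals all_analysis measurable_realfun.

Set Implicit Arguments.
Unset Strict Implicit.
Unset Printing Implicit Defensive.

Import Order.TTheory GRing.Theory Num.Theory numFieldNormedType.Exports.

Local Open Scope classical_set_scope.
Local Open Scope ring_scope.

(* As for measures in the library, the set function is total on [set X]; only
   its values on measurable sets are constrained.  Nonemptiness of X is part of
   [measurableType]. *)
Record nonadditive_measure d (X : measurableType d) (R : realType) := NonadditiveMeasure {
  nam_fun :> set X -> \bar R ;
  nam_set0 : nam_fun set0 = 0%E ;
  nam_ge0 : forall A, measurable A -> (0 <= nam_fun A)%E ;
  nam_mono : forall A B, measurable A -> measurable B -> A `<=` B ->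
    (nam_fun A <= nam_fun B)%E }.

Section properties.
Context d (X : measurableType d) (R : realType).
Variable mu : nonadditive_measure X R.

Definition monotone_autocontinuous_below := forall (A : set X) (B : (set X)^nat),
  measurable A -> (forall n, measurable (B n)) ->
  (forall m n, (m <= n)%N -> B n `<=` B m) ->
  mu (B n) @[n --> \oo] --> 0%E ->
  mu (A `\` B n) @[n --> \oo] --> mu A.

Definition null_additive := forall A B : set X, measurable A -> measurable B ->
  mu B = 0%E -> mu (A `|` B) = mu A.

Definition property_C := forall E : (set X)^nat, (forall n, measurable (E n)) ->
  ereal_sup (range (fun l : nat =>
    mu (\bigcup_(n in [set n | (k <= n <= k + l)%N]) E n))) @[k --> \oo] --> 0%E ->
  mu (\bigcup_(n >= k) E n) @[k --> \oo] --> 0%E.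

Definition pgp := forall A B : (set X)^nat,
  (forall n, measurable (A n)) -> (forall n, measurable (B n)) ->
  maxe (mu (A n)) (mu (B n)) @[n --> \oo] --> 0%E ->
  mu (A n `|` B n) @[n --> \oo] --> 0%E.

Lemma monotone_autocontinuous_null_additive :
  monotone_autocontinuous_below -> null_additive.
Proof.
move=> mac A B mA mB muB0.
have mAB : measurable (A `|` B) by exact: measurableU.
apply/eqP; rewrite eq_le; apply/andP; split; last by apply: nam_mono => // x; left.
have cB : mu B @[_ --> \oo] --> 0%E by rewrite muB0; exact: cvg_cst.
have cAB := mac _ (fun=> B) mAB (fun=> mB) (fun _ _ _ => @subset_refl _ B) cB.
have <- : mu ((A `|` B) `\` B) = mu (A `|` B).
  by apply: (cvg_unique _ (cvg_cst _) cAB).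
by apply: nam_mono; [exact: measurableD| |move=> x [[]]].
Qed.

End properties.

Section choquet_lorentz.
Context d (X : measurableType d) (R : realType).
Implicit Types (nu : set X -> \bar R) (mu : nonadditive_measure X R) (p q : R).

Definition choquet nu (g : X -> R) : \bar R :=
  (\int[lebesgue_measure]_(t in `[0%R, +oo[) nu [set x | (t < g x)%R])%E.

Definition pqnorm mu p q (f : {mfun X >-> R}) : \bar R :=
  (((p / q) `^ q^-1)%:E *
   choquet (fun A => mu A `^ (q / p)) (fun x => `|f x| `^ q)%R `^ q^-1)%E.

Definition Lpq mu p q : set {mfun X >-> R} := [set f | (pqnorm mu p q f < +oo)%E].

End choquet_lorentz.

Section quotient.
Context d (X : measurableType d) (R : realType).
Variable mu : nonadditive_measure X R.
Local Notation F0 := {mfun X >-> R}.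
Implicit Types f g h : F0.

Definition aeq : rel F0 := fun f g =>
  `[< forall c : R, 0 < c -> mu [set x | c < `|f x - g x|] = 0%E >].

Let measurable_gt f (c : R) : measurable [set x | c < `|f x|].
Proof.
rewrite -[X in measurable X]setTI.
have mf : measurable_fun setT (fun x => `|f x|) by exact: measurableT_comp.
by have := mf measurableT _ (measurable_itv `]c, +oo[);
  congr measurable; apply/seteqP; split => x /=; rewrite in_itv/= andbT.
Qed.

Let measurable_gtB f g (c : R) : measurable [set x | c < `|f x - g x|].
Proof. by have := measurable_gt (f - g) c; rewrite mfunB. Qed.

Hypothesis mac : monotone_autocontinuous_below mu.

Lemma aeq_refl : reflexive aeq.
Proof.
move=> f; apply/asboolP => c c0.
rewrite (_ : [set _ | _] = set0) ?nam_set0// -subset0 => x /=.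
by rewrite subrr normr0 ltNge ltW.
Qed.

Lemma aeq_sym : symmetric aeq.
Proof.
by move=> f g; apply/asboolP/asboolP => fg c /fg <-; congr (mu _);
  apply/funext => x /=; rewrite distrC.
Qed.

Let aeq_lift f1 g1 f2 g2 f g : aeq f1 g1 -> aeq f2 g2 ->
  (forall x, `|f x - g x| <= `|f1 x - g1 x| + `|f2 x - g2 x|) -> aeq f g.
Proof.
move=> /asboolP e1 /asboolP e2 le12; apply/asboolP => c c0.
have c20 : 0 < c / 2 by rewrite divr_gt0.
have m1 := measurable_gtB f1 g1 (c / 2); have m2 := measurable_gtB f2 g2 (c / 2).
apply/eqP; rewrite eq_le (nam_ge0 _ (measurable_gtB _ _ _)) andbT.
rewrite -[leRHS](e1 _ c20).
rewrite -(monotone_autocontinuous_null_additive mac m1 m2 (e2 _ c20)).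
apply: nam_mono; [exact: measurable_gtB|exact: measurableU|move=> x /= cfg].
have [|le1] := ltP (c / 2) `|f1 x - g1 x|; first by left.
right; rewrite ltNge; apply/negP => le2; move: cfg; apply/negP; rewrite -leNgt.
by rewrite (le_trans (le12 x))// [leRHS]splitr lerD.
Qed.

Lemma aeq_trans : transitive aeq.
Proof. by move=> g f h fg /(aeq_lift fg); apply => x; exact: ler_distD. Qed.

Definition aeq_equiv : equiv_rel F0 := EquivRel aeq aeq_refl aeq_sym aeq_trans.

Local Open Scope quotient_scope.

Definition L0 : Type := {eq_quot aeq_equiv}.
HB.instance Definition _ := Choice.on L0.
HB.instance Definition _ := EqQuotient.on L0.

Lemma L0_eqP f g : reflect (\pi_L0 f = \pi_L0 g) (aeq f g).
Proof. by apply: (iffP idP) => [fg|/eqmodP//]; exact/eqmodP. Qed.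

Let repr_aeq f : aeq (repr (\pi_L0 f)) f.
Proof. by apply/L0_eqP; rewrite reprK. Qed.

Definition L0_zero : L0 := \pi_L0 0.
Definition L0_opp (x : L0) : L0 := \pi_L0 (- repr x).
Definition L0_add (x y : L0) : L0 := \pi_L0 (repr x + repr y).

Lemma L0_pi_opp f : L0_opp (\pi_L0 f) = \pi_L0 (- f).
Proof.
apply/L0_eqP; apply: (aeq_lift (repr_aeq f) (aeq_refl 0)) => x.
by rewrite !mfunN subrr normr0 addr0 -opprD normrN.
Qed.

Lemma L0_pi_add f g : L0_add (\pi_L0 f) (\pi_L0 g) = \pi_L0 (f + g).
Proof.
apply/L0_eqP; apply: (aeq_lift (repr_aeq f) (repr_aeq g)) => x.
by rewrite !mfunD /= opprD addrACA ler_normD.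
Qed.

Let L0_addA : associative L0_add.
Proof.
elim/quotW=> f; elim/quotW=> g; elim/quotW=> h.
by rewrite (L0_pi_add g h) (L0_pi_add f g) !L0_pi_add addrA.
Qed.

Let L0_addC : commutative L0_add.
Proof. by move=> x y; rewrite /L0_add addrC. Qed.

Let L0_add0 : left_id L0_zero L0_add.
Proof. by elim/quotW=> f; rewrite L0_pi_add add0r. Qed.

Let L0_addN : left_inverse L0_zero L0_opp L0_add.
Proof. by elim/quotW=> f; rewrite L0_pi_opp L0_pi_add addNr. Qed.

HB.instance Definition _ :=
  GRing.isZmodule.Build L0 L0_addA L0_addC L0_add0 L0_addN.

(* The choice of representative is immaterial: [pqnorm] is constant on classes,
   because [mu] is null-additive. *)
Definition class_pqnorm (p q : R) (x : L0) : \bar R := pqnorm mu p q (repr x).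

Definition class_Lpq (p q : R) : set L0 := \pi_L0 @` Lpq mu p q.

End quotient.
Arguments class_pqnorm {d X R mu} mac p q x.
Arguments class_Lpq {d X R mu} mac p q.

(* [S] need not be a subgroup: differences are taken in the ambient group [V]. *)
Section quasi_completeness.
Context (R : realType) (V : zmodType) (N : V -> \bar R).
Implicit Types (u : V^nat) (S : set V).

Definition cvg_for u (l : V) := N (u n - l) @[n --> \oo] --> 0%E.

Definition cauchy_for u := forall e : R, 0 < e -> exists n0 : nat,
  forall m n : nat, (n0 <= m)%N -> (n0 <= n)%N -> (N (u m - u n) < e%:E)%E.

Definition bounded_for u := (ereal_sup (range (N \o u)) < +oo)%E.

Definition quasi_complete S := forall u, (forall n, S (u n)) ->
  bounded_for u -> cauchy_for u -> exists2 l, S l & cvg_for u l.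

End quasi_completeness.

(* Main.v *)
Require Import Defs.
From mathcomp Require Import all_boot all_order all_algebra generic_quotient.
From mathcomp Require Import all_classical all_reals all_analysis measurable_realfun.
From mathcomp Require Import lra.

(* By a Chebyshev inequality a Cauchy sequence is Cauchy in measure; (p.g.p.)
   and (C) then give a subsequence converging uniformly to some f off sets G k
   that decrease and whose measure vanishes.  Monotone autocontinuity makes the
   superlevel sets lower semicontinuous up to a small shift of the level, and a
   shift of the level changes a nonincreasing function of the level at only
   countably many points; hence the norm satisfies Fatou's lemma for this
   convergence.  Applied to the subsequence itself (which is bounded), Fatou's
   lemma shows that f has finite norm; applied to u n - u (phi i) as i grows, it
   shows that u converges to f. *)

Set Implicit Arguments.
Unset Strict Implicit.
Unset Printing Implicit Defensive.

Import Order.TTheory GRing.Theory Num.Theory numFieldNormedType.Exports.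

Local Open Scope classical_set_scope.
Local Open Scope ring_scope.

(** * Monotone functions of a real level and lower limits in the extended reals *)

Lemma rat_between_ereal (R : realType) (x y : \bar R) : (x < y)%E ->
  exists r : rat, (x < (ratr r)%:E < y)%E.
Proof.
have H (a b : R) : (a < b)%R -> exists r : rat, (a%:E < (ratr r)%:E < b%:E)%E.
  move=> /rat_in_itvoo[r]; rewrite in_itv/= => ab.
  by exists r; rewrite !lte_fin.
move: x y => [a| |] [b| |]//.
- by rewrite lte_fin; exact: H.
- have [r /andP[ar _]] := H a (a + 1) (ltr_pwDr ltr01 (lexx a)).
  by exists r; rewrite ar ltry.
- have [|r /andP[_ rb]] := H (b - 1) b; first by rewrite ltrBlDr ltrDl.
  by exists r; rewrite rb ltNyr.
- by exists 0; rewrite ltNyr ltry.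
Qed.

(** By monotonicity, the points of [D] where [F] exceeds a given value form an interval, and such
    preimages generate measurability. *)
Lemma nonincreasing_emeasurable (R : realType) (D : set R) (F : R -> \bar R) :
  is_interval D ->
  (forall s t, D s -> D t -> s <= t -> (F t <= F s)%E) -> measurable_fun D F.
Proof.
move=> iD Fni mD; apply: (measurability _ (ErealGenOInfty.measurableE R)) => //.
move=> _ [_ [y ->] <-]; apply: is_interval_measurable => s t/=.
rewrite !in_itv/= !andbT => -[Ds _] [Dt yt] u /andP[su ut].
have Du : D u by apply: (iD s t) => //; rewrite su ut.
by rewrite in_itv/= andbT; split => //; rewrite (lt_le_trans yt)// Fni.
Qed.

(* The open intervals ]G t, F t[ attached to the points t where G t < F t are
   disjoint and contain a rational, so there are countably many of them. *)
Lemma le_integral_interlaced (R : realType) (D : set R) (F G : R -> \bar R) :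
  measurable D -> measurable_fun D F -> measurable_fun D G ->
  (forall t, D t -> (0 <= F t)%E) -> (forall t, D t -> (0 <= G t)%E) ->
  (forall s t, D s -> D t -> s < t -> (F t <= G s)%E) ->
  (\int[lebesgue_measure]_(t in D) F t <= \int[lebesgue_measure]_(t in D) G t)%E.
Proof.
move=> mD mF mG F0 G0 FG; apply: ae_ge0_le_integral => //.
pose A := [set t | D t /\ (G t < F t)%E].
have cA : countable A.
  have /choice[r rA] : forall t, exists r : rat, A t ->
      (G t < (ratr r)%:E < F t)%E.
    move=> t; have [At|nAt] := pselect (A t); last by exists 0.
    by have [r Hr] := rat_between_ereal At.2; exists r.
  apply/countable_injP; exists (pickle \o r) => s t /set_mem As /set_mem At /=.
  move=> /(pcan_inj pickleK) rst.
  (* [r] strictly decreases on [A], since [ratr (r b) < F b <= G a < ratr (r a)] for [a < b]; hence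
     it is injective there. *)
  have lt_r a b : A a -> A b -> a < b -> (ratr (r b) < ratr (r a) :> R).
    move=> Aa Ab ab; have /andP[_ rb] := rA _ Ab; have /andP[ra _] := rA _ Aa.
    rewrite -lte_fin (lt_le_trans rb)// (le_trans _ (ltW ra))//.
    exact: FG Aa.1 Ab.1 ab.
  case: (ltgtP s t) => // st; have := lt_r _ _ _ _ st.
  - by rewrite rst ltxx => /(_ As At).
  - by rewrite rst ltxx => /(_ At As).
exists A; split; [|exact: countable_lebesgue_measure0|].
  exact: countable_measurable.
move=> t /= /not_implyP[Dt /negP]; rewrite -ltNge => GF; split => //.
Qed.

Lemma le_limn_einf (R : realType) (u : (\bar R)^nat) (c : \bar R) :
  (\forall n \near \oo, (c <= u n)%E) -> (c <= limn_einf u)%E.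
Proof.
move=> cu; rewrite limn_einf_lim; apply: lime_ge; first exact: is_cvg_einfs.
move: cu => [N _ cu]; exists N => // n /= Nn.
apply: le_ereal_inf_tmp => _ [m /= nm <-]; apply: cu => /=.
exact: leq_trans Nn nm.
Qed.

Lemma limn_einf_le (R : realType) (u : (\bar R)^nat) (c : \bar R) :
  (\forall n \near \oo, (u n <= c)%E) -> (limn_einf u <= c)%E.
Proof.
move=> uc; rewrite limn_einf_lim; apply: lime_le; first exact: is_cvg_einfs.
apply: filterS uc => n; apply: le_trans.
by apply: ereal_inf_lbound; exists n => //=.
Qed.

Lemma limn_einf_mono (R : realType) (u v : (\bar R)^nat) :
  (forall n, (u n <= v n)%E) -> (limn_einf u <= limn_einf v)%E.
Proof.
move=> uv; rewrite !limn_einf_lim; apply: lee_lim; [exact: is_cvg_einfs..|].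
apply: nearW => n; apply: le_ereal_inf_tmp => _ [m nm <-].
by apply: le_trans (uv m); apply: ereal_inf_lbound; exists m.
Qed.

(** * Fatou's lemma for the Choquet integral *)

Section choquet_fatou.
Context d (X : measurableType d) (R : realType).

Lemma measurable_superlevel (g : X -> R) (c : R) :
  measurable_fun setT g -> measurable [set x | c < g x].
Proof.
move=> mg; rewrite -[X in measurable X]setTI -preimage_itvoy.
exact: mg.
Qed.

(** Since [nu] is not additive, the classical Fatou lemma is applied in the level variable, to the
    functions [t |-> nu {g_ n > t}]. The hypothesis compares only distinct levels [s < t], which is
    the interlacing condition under which integrals can still be compared. *)
Lemma choquet_fatou (nu : nonadditive_measure X R) (g : X -> R)
    (g_ : (X -> R)^nat) :
  measurable_fun setT g -> (forall n, measurable_fun setT (g_ n)) ->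
  (forall s t : R, 0 <= s -> s < t ->
    (nu [set x | (t < g x)%R] <=
     limn_einf (fun n => nu [set x | (s < g_ n x)%R]))%E) ->
  (choquet nu g <= limn_einf (fun n => choquet nu (g_ n)))%E.
Proof.
move=> mg mg_ gg_; rewrite /choquet.
have lev_ni (h : X -> R) s t : measurable_fun setT h -> s <= t ->
    (nu [set x | (t < h x)%R] <= nu [set x | (s < h x)%R])%E.
  move=> mh st; apply: nam_mono; [exact: measurable_superlevel..|].
  by move=> x /=; apply: le_lt_trans.
have iD : is_interval (`[0, +oo[%classic : set R) by exact: interval_is_interval.
have mF n : measurable_fun (`[0, +oo[%classic : set R)
    (fun t => nu [set x | (t < g_ n x)%R]).
  by apply: nonincreasing_emeasurable => // s t _ _; exact: lev_ni.
have F0 n t : (`[0, +oo[%classic : set R) t -> (0 <= nu [set x | (t < g_ n x)%R])%E.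
  by move=> _; apply: nam_ge0; exact: measurable_superlevel.
have mD : measurable (`[0, +oo[%classic : set R) by [].
apply: le_trans (fatou lebesgue_measure mD mF F0).
apply: le_integral_interlaced => //.
- by apply: nonincreasing_emeasurable => // s t _ _; exact: lev_ni.
- apply: nonincreasing_emeasurable => // s t _ _ st.
  by apply: limn_einf_mono => n; exact: lev_ni.
- by move=> t _; apply: nam_ge0; exact: measurable_superlevel.
- by move=> t Dt; apply: le_limn_einf; apply: nearW => n; exact: F0.
- by move=> s t /=; rewrite in_itv/= andbT => s0 _; exact: gg_.
Qed.

End choquet_fatou.

(** * Moving positive exponents across inequalities *)

Lemma le_poweR (R : realType) (r : R) (x y : \bar R) : 0 < r ->
  (0 <= x)%E -> (x <= y)%E -> (x `^ r <= y `^ r)%E.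
Proof.
move=> r0 x0 xy; apply: gt0_ler_poweR => //; first exact: ltW.
  by rewrite in_itv/= x0 leey.
by rewrite in_itv/= (le_trans x0 xy) leey.
Qed.

Lemma poweR_le_poweRV (R : realType) (r : R) (x y : \bar R) : 0 < r ->
  (0 <= x)%E -> (0 <= y)%E -> (x `^ r <= y)%E = (x <= y `^ r^-1)%E.
Proof.
move=> r0 x0 y0; have rV0 : 0 < r^-1 by rewrite invr_gt0.
apply/idP/idP => [/(le_poweR rV0 (poweR_ge0 _ _))|/(le_poweR r0 x0)];
  by rewrite -poweRrM ?(mulVf, mulfV) ?gt_eqF// poweRe1.
Qed.

Lemma ltr_powRV (R : realType) (q t a : R) : 0 < q -> 0 <= t -> 0 <= a ->
  (t < a `^ q) = (t `^ q^-1 < a).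
Proof.
move=> q0 t0 a0; rewrite !ltNge -!lee_fin -[in LHS]poweR_EFin.
by rewrite poweR_le_poweRV ?lee_fin// poweR_EFin lee_fin.
Qed.

(** * Fatou and Chebyshev properties of the Lorentz norm *)

Section lorentz.
Context d (X : measurableType d) (R : realType).
Implicit Types (mu : nonadditive_measure X R) (p q : R).
Local Notation F0 := {mfun X >-> R}.
Implicit Types (f g : F0).

(** Bundling the power makes monotonicity and the Fatou lemma available for the set function inside
    [pqnorm]; [Defined] keeps it convertible to the function written there. *)
Definition nam_poweR mu (r : R) (r0 : 0 < r) : nonadditive_measure X R.
Proof.
exists (fun A => mu A `^ r)%E.
- by rewrite nam_set0 poweR0r// gt_eqF.
- by move=> A mA; exact: poweR_ge0.
- by move=> A B mA mB AB; apply: le_poweR; rewrite ?nam_ge0//; exact: nam_mono.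
Defined.

Lemma measurable_norm_gt f (c : R) : measurable [set x | c < `|f x|].
Proof. by apply: measurable_superlevel; exact: measurableT_comp. Qed.

Lemma measurable_norm_powR q f : measurable_fun setT (fun x => `|f x| `^ q).
Proof.
apply: (measurableT_comp (measurable_powR q)); exact: measurableT_comp.
Qed.

(* Almost uniform convergence would make [G] independent of [e]; letting it
   depend on [e] also covers [f_ n = g] for any [g] equivalent to [f]. *)
Definition cvg_off_vanishing mu (f_ : F0^nat) f := forall e : R, 0 < e ->
  exists G : (set X)^nat, [/\ forall k, measurable (G k),
    forall m n, (m <= n)%N -> G n `<=` G m,
    mu (G k) @[k --> \oo] --> 0%E &
    forall k, \forall n \near \oo, [set x | e < `|f_ n x - f x|] `<=` G k].

(** Take exceptional sets [G k] for the tolerance [t - s]. For large [n], a point outside [G k] with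
    [|f| > t] satisfies [|f_ n| > s], so the lower limit dominates the power of the measure of
    [{|f| > t}] minus [G k]. Monotone autocontinuity removes [G k] as [k] grows. *)
Lemma superlevel_fatou mu (r s t : R) (f_ : F0^nat) f :
  monotone_autocontinuous_below mu ->
  cvg_off_vanishing mu f_ f -> 0 < r -> s < t ->
  (mu [set x | (t < `|f x|)%R] `^ r <=
   limn_einf (fun n => mu [set x | (s < `|f_ n x|)%R] `^ r))%E.
Proof.
move=> mac f_f r0 st; set psi := limn_einf _.
have ts0 : 0 < t - s by rewrite subr_gt0.
have [G [mG Gni muG Gf]] := f_f _ ts0.
have mA := measurable_norm_gt f t.
have psi0 : (0 <= psi)%E.
  by apply: le_limn_einf; apply: nearW => n; exact: poweR_ge0.
rewrite poweR_le_poweRV//; last exact: nam_ge0.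
apply: cvge_le (mac _ _ mA mG Gni muG); apply: nearW => k.
have mAG : measurable ([set x | t < `|f x|] `\` G k) by exact: measurableD.
rewrite -poweR_le_poweRV//; last exact: nam_ge0.
apply: le_limn_einf; apply: filterS (Gf k) => n GAn.
apply: (nam_mono (nam_poweR mu r0)) => //; first exact: measurable_norm_gt.
move=> x [/= tf nGx]; rewrite ltNge; apply/negP => fs; apply: nGx; apply: GAn.
rewrite /= ltrBlDr (lt_le_trans tf)//.
rewrite distrC -[in leLHS](subrK (f_ n x) (f x)).
by rewrite (le_trans (ler_normD _ _))// lerD.
Qed.

Lemma choquet_norm_ge0 mu p q f :
  (0 <= choquet (fun A => mu A `^ (q / p)) (fun x => `|f x| `^ q)%R)%E.
Proof. by apply: integral_ge0 => t _; exact: poweR_ge0. Qed.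

Lemma pqnorm_ge0 mu p q f : (0 <= pqnorm mu p q f)%E.
Proof. by apply: mule_ge0; rewrite ?lee_fin ?powR_ge0 ?poweR_ge0. Qed.

(** With the constant and the root moved to the side of [M], a norm bound becomes a bound on the
    Choquet integral, and no lower limit has to pass through a power. *)
Lemma pqnorm_le mu p q f (M : \bar R) : 0 < p -> 0 < q -> (0 <= M)%E ->
  (pqnorm mu p q f <= M)%E =
  (choquet (fun A => mu A `^ (q / p)) (fun x => `|f x| `^ q)%R <=
   ((((p / q) `^ q^-1)^-1)%:E * M) `^ q)%E.
Proof.
move=> p0 q0 M0; have K0 : 0 < (p / q) `^ q^-1 by rewrite powR_gt0// divr_gt0.
rewrite /pqnorm -lee_pdivlMl// poweR_le_poweRV ?invr_gt0 ?invrK//.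
- exact: choquet_norm_ge0.
- by rewrite mule_ge0// lee_fin invr_ge0 ltW.
Qed.

(** The level [u] of [|f|^q] is the level [u^(1/q)] of [|f|]; as the root is strictly increasing,
    the gap between two levels survives the change of variable. *)
Lemma pqnorm_fatou mu p q (f_ : F0^nat) f (M : \bar R) :
  monotone_autocontinuous_below mu -> 0 < p -> 0 < q ->
  cvg_off_vanishing mu f_ f ->
  (\forall n \near \oo, (pqnorm mu p q (f_ n) <= M)%E) ->
  (pqnorm mu p q f <= M)%E.
Proof.
move=> mac p0 q0 f_f f_M.
have M0 : (0 <= M)%E.
  have [N _ NM] := f_M; apply: le_trans (NM _ (leqnn N)); exact: pqnorm_ge0.
have r0 : 0 < q / p by rewrite divr_gt0.
rewrite pqnorm_le//.
apply: (@le_trans _ _ (limn_einf (fun n => choquet (nam_poweR mu r0)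
    (fun x => `|f_ n x| `^ q)%R))); last first.
  by apply: limn_einf_le; apply: filterS f_M => n; rewrite pqnorm_le.
apply: (@choquet_fatou _ _ _ (nam_poweR mu r0)).
- exact: measurable_norm_powR.
- by move=> n; exact: measurable_norm_powR.
move=> s t s0 st.
have level g u : 0 <= u ->
    [set x | u < `|g x| `^ q] = [set x | u `^ q^-1 < `|g x|].
  by move=> u0; apply/funext => x /=; rewrite ltr_powRV.
have t0 : 0 <= t by rewrite (le_trans s0) ?ltW.
rewrite level//; under [X in limn_einf X]eq_fun do rewrite level//.
apply: superlevel_fatou => //.
by rewrite gt0_ltr_powR ?invr_gt0 ?nnegrE.
Qed.

(** If [mu {|f| > c} >= eta], the integrand is at least [eta^(q/p)] on [[0, c^q[], which bounds the
    norm below independently of [f]. *)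
Lemma pqnorm_chebyshev mu p q (c eta : R) : 0 < p -> 0 < q -> 0 < c -> 0 < eta ->
  exists2 e : R, 0 < e & forall f, (pqnorm mu p q f < e%:E)%E ->
    (mu [set x | (c < `|f x|)%R] < eta%:E)%E.
Proof.
move=> p0 q0 c0 eta0; have r0 : 0 < q / p by rewrite divr_gt0.
have K0 : 0 < (p / q) `^ q^-1 by rewrite powR_gt0// divr_gt0.
(* The value of [pqnorm] when its integral is replaced by the lower bound [eta^(q/p) * c^q]. *)
exists ((p / q) `^ q^-1 * (eta `^ (q / p) * c `^ q) `^ q^-1).
  by rewrite mulr_gt0// powR_gt0// mulr_gt0// powR_gt0.
move=> f; rewrite !ltNge; apply: contra => etaf.
rewrite /pqnorm EFinM lee_pmul2l// ?lte_fin// -poweR_EFin.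
have etaq0 : 0 <= eta `^ (q / p) by exact: powR_ge0.
apply: le_poweR; rewrite ?invr_gt0//.
  by rewrite lee_fin mulr_ge0// powR_ge0.
pose F (t : R) := nam_poweR mu r0 [set x | (t < `|f x| `^ q)%R].
have mq := measurable_norm_powR q f.
have F0 t : (0 <= F t)%E by exact: poweR_ge0.
have mF (D : set R) : is_interval D -> measurable_fun D F.
  move=> iD; apply: nonincreasing_emeasurable => // s t _ _ st.
  apply: nam_mono; [exact: measurable_superlevel..|].
  by move=> x /=; apply: le_lt_trans.
pose D : set R := `[0, c `^ q[%classic.
have iD : is_interval D by exact: interval_is_interval.
have mD : measurable D by exact: measurable_itv.
have lebD : lebesgue_measure D = (c `^ q)%:E.
  by rewrite /D lebesgue_measure_itv/= lte_fin powR_gt0// -EFinB subr0.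
have -> : (eta `^ (q / p) * c `^ q)%:E =
    (\int[lebesgue_measure]_(t in D) (eta `^ (q / p))%:E)%E.
  by rewrite integral_cst// EFinM -lebD.
apply: (@le_trans _ _ (\int[lebesgue_measure]_(t in D) F t)%E).
  apply: ge0_le_integral => //.
  - exact: mF.
  - move=> t; rewrite /D/= in_itv/= => /andP[t0 tc].
    rewrite -poweR_EFin; apply: le_poweR => //; first by rewrite lee_fin ltW.
    apply: (le_trans etaf); apply: nam_mono => //.
    + exact: measurable_norm_gt.
    + exact: measurable_superlevel.
    + move=> x /= cf; rewrite (lt_trans tc)//.
      by rewrite gt0_ltr_powR// nnegrE// ltW.
apply: ge0_subset_integral => //.
- by apply: mF; exact: interval_is_interval.
- by move=> t; rewrite /D/= !in_itv/= => /andP[->].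
Qed.
End lorentz.

(** * Convergence criteria for sequences *)

Lemma cvge0_eps (R : realType) (u : (\bar R)^nat) : (forall n, (0 <= u n)%E) ->
  (forall e : R, 0 < e -> \forall n \near \oo, (u n <= e%:E)%E) ->
  u n @[n --> \oo] --> 0%E.
Proof.
move=> u0 ue; apply/fine_cvgP; split.
  apply: filterS (ue _ ltr01) => n un1.
  by rewrite ge0_fin_numE// (le_lt_trans un1)// ltry.
apply/cvgrPdist_le => e e0; apply: filterS (ue _ e0) => n une /=.
have une_fin : u n \is a fin_num by rewrite ge0_fin_numE// (le_lt_trans une)// ltry.
by rewrite sub0r normrN ger0_norm ?fine_ge0// -lee_fin fineK.
Qed.

Lemma near_halfX_lt (R : realType) (c e : R) : 0 < e ->
  \forall i \near \oo, c * 2^-1 ^+ i < e.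
Proof.
have half_lt1 : `|2^-1 : R| < 1 by rewrite ger0_norm// invf_lt1// ltr1n.
by move=> e0; exact: cvgr_lt (cvg_geometric c half_lt1) _ e0.
Qed.

Lemma cvgn_halving_increments (R : realType) (h : R^nat) (k : nat) :
  (forall i, (k <= i)%N -> `|h i.+1 - h i| <= 2^-1 ^+ i) ->
  cvgn h /\ forall i, (k <= i)%N -> `|h i - limn h| <= 2 * 2^-1 ^+ i.
Proof.
move=> hk.
have half_rec i : 2 * 2^-1 ^+ i.+1 = 2^-1 ^+ i :> R.
  by rewrite exprS mulrA divff// mul1r.
have hD i m : (k <= i)%N -> `|h (i + m)%N - h i| <= 2 * 2^-1 ^+ i.
  move=> ki.
  (* Keeping the remaining geometric tail in the bound makes the induction on [m] close. *)
  suff : `|h (i + m)%N - h i| <= 2 * 2^-1 ^+ i - 2 * 2^-1 ^+ (i + m).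
    by move=> /le_trans; apply; rewrite gerBl mulr_ge0// exprn_ge0.
  elim: m => [|m IH]; first by rewrite addn0 !subrr normr0.
  rewrite addnS (le_trans (ler_distD (h (i + m)%N) _ _))//.
  have := lerD (hk _ (leq_trans ki (leq_addr m i))) IH; move/le_trans; apply.
  by rewrite half_rec; lra.
have h_cvg : cvgn h.
  apply/cauchy_cvgP/cauchy_exP => _/posnumP[e].
  have [N _ Ne] := near_halfX_lt 2 (gt0 e).
  pose i := maxn N k; exists (h i); exists i => // j /= ij.
  rewrite /ball/= distrC -(subnKC ij) (le_lt_trans (hD _ _ (leq_maxr _ _)))//.
  by apply: Ne; exact: leq_maxl.
split => // i ki; rewrite distrC.
have hi_cvg : `|h j - h i| @[j --> \oo] --> `|limn h - h i|.
  by apply: cvg_norm; apply: cvgB => //; exact: cvg_cst.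
apply: (cvgr_to_le hi_cvg); exists i => // j /= ij.
by rewrite -(subnKC ij); exact: hD.
Qed.

(** * Extraction of a convergent subsequence from a sequence Cauchy in measure *)

Section subsequence.
Context d (X : measurableType d) (R : realType).
Variable mu : nonadditive_measure X R.
Local Notation F0 := {mfun X >-> R}.

(** If every threshold [1/(n+1)] failed, the chosen counterexamples would form two sequences
    contradicting (p.g.p.). *)
Lemma pgp_eps : pgp mu -> forall e : R, 0 < e -> exists2 a : R, 0 < a &
  forall A B, measurable A -> measurable B -> (mu A < a%:E)%E -> (mu B < a%:E)%E ->
    (mu (A `|` B) < e%:E)%E.
Proof.
move=> mupgp e e0; apply: contrapT => nH.
have /choice[AB HAB] : forall n : nat, exists AB : set X * set X,
    [/\ measurable AB.1, measurable AB.2, (mu AB.1 < n.+1%:R^-1%:E)%E,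
      (mu AB.2 < n.+1%:R^-1%:E)%E & (e%:E <= mu (AB.1 `|` AB.2))%E].
  move=> n; apply: contrapT => nAB; apply: nH.
  exists (n.+1%:R^-1) => [|A B mA mB An Bn]; first by rewrite invr_gt0.
  by rewrite ltNge; apply/negP => ABe; apply: nAB; exists (A, B).
have cAB : mu ((AB n).1 `|` (AB n).2) @[n --> \oo] --> 0%E.
  apply: mupgp => [n|n|]; [by case: (HAB n)|by case: (HAB n)|].
  apply: cvge0_eps => [n|a a0].
    by have [mA _ _ _ _] := HAB n; rewrite le_max nam_ge0.
  near=> n; have [_ _ An Bn _] := HAB n; rewrite ge_max.
  have na : (n.+1%:R^-1%:E <= a%:E)%E.
    by rewrite lee_fin ltW//; near: n; exact: near_infty_natSinv_lt (PosNum a0).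
  by rewrite (le_trans (ltW An) na) (le_trans (ltW Bn) na).
suff : (e%:E <= 0)%E by rewrite leNgt lte_fin e0.
by apply: cvge_ge cAB; apply: nearW => n; have [] := HAB n.
Unshelve. all: by end_near. Qed.

Lemma mfun_of_measurable (f : X -> R) : measurable_fun setT f ->
  exists g : F0, g = f :> (X -> R).
Proof. by move=> mf; exists (mfun_Sub (mem_set mf)). Qed.

(* The thresholds [del i] are chosen so that a union of two sets of measure
   less than [del i.+1] has measure less than [del i]; hence finite unions of
   sets [E i] with [mu (E i) < del i.+1] are controlled uniformly in their
   length, which is what property (C) requires. *)
Lemma cauchy_measure_cvg_off (f_ : F0^nat) : property_C mu -> pgp mu ->
  (forall c e : R, 0 < c -> 0 < e -> exists N, forall m n : nat,
    (N <= m)%N -> (N <= n)%N ->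
    (mu [set x | (c < `|(f_ m - f_ n) x|)%R] < e%:E)%E) ->
  exists2 phi : nat -> nat, (forall n, (n <= phi n)%N) &
    exists f, cvg_off_vanishing mu (f_ \o phi) f.
Proof.
move=> muC mupgp f_cauchy.
(* The bound by [e / 2] is added so that the iterates [del i] tend to 0; the value of [D] at
   nonpositive [e] is a dummy. *)
have /choice[D HD] : forall e : R, exists a : R, 0 < e ->
    [/\ 0 < a, a <= e * 2^-1 & forall A B, measurable A -> measurable B ->
      (mu A < a%:E)%E -> (mu B < a%:E)%E -> (mu (A `|` B) < e%:E)%E].
  move=> e; have [e0|_] := ltP 0 e; last by exists 0.
  have [a a0 Ha] := pgp_eps mupgp e0; exists (Num.min a (e * 2^-1)) => _; split.
  - by rewrite lt_min a0/= mulr_gt0.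
  - by rewrite ge_min lexx orbT.
  - move=> A B mA mB Aa Ba; apply: Ha => //.
    + by rewrite (lt_le_trans Aa)// lee_fin ge_min lexx.
    + by rewrite (lt_le_trans Ba)// lee_fin ge_min lexx.
pose del i := iter i D 1.
have del0 i : 0 < del i by elim: i => //= i /HD[].
have del_half i : del i <= 2^-1 ^+ i.
  elim: i => [|i IH]; first by rewrite expr0.
  have [_ + _] := HD _ (del0 i); move=> /le_trans; apply.
  by rewrite exprSr ler_pM2r.
have half0 i : 0 < 2^-1 ^+ i :> R by rewrite exprn_gt0.
have /choice[N HN] : forall i, exists N, forall m n, (N <= m)%N -> (N <= n)%N ->
    (mu [set x | (2^-1 ^+ i < `|(f_ m - f_ n) x|)%R] < (del i.+1)%:E)%E.
  by move=> i; exact: f_cauchy.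
(* Summing successors makes [phi] strictly increasing with [N i <= phi i], so both indices compared
   in [E i] lie beyond [N i]. *)
pose phi i := (\sum_(j < i.+1) (N j).+1)%N.
have phiS i : phi i.+1 = (phi i + (N i.+1).+1)%N by rewrite /phi big_ord_recr.
have phi_ge i : (i < phi i)%N.
  elim: i => [|i IH]; first by rewrite /phi big_ord1.
  by rewrite phiS addnS ltnS (leq_trans IH)// leq_addr.
have phiN i : (N i <= phi i)%N.
  case: i => [|i]; first by rewrite /phi big_ord1.
  by rewrite phiS addnS ltnW// ltnS leq_addl.
exists phi => [n|]; first exact: ltnW.
pose E i := [set x | 2^-1 ^+ i < `|(f_ (phi i.+1) - f_ (phi i)) x|].
have mE i : measurable (E i) by exact: measurable_norm_gt.
have muE i : (mu (E i) < (del i.+1)%:E)%E.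
  apply: HN; last exact: phiN.
  by rewrite (leq_trans (phiN i))// phiS leq_addr.
pose U k l := \bigcup_(n in [set n | (k <= n <= k + l)%N]) E n.
have mU k l : measurable (U k l) by apply: bigcup_measurable => n _.
have muU l k : (mu (U k l) < (del k)%:E)%E.
  elim: l k => [|l IH] k.
    have -> : U k 0 = E k.
      apply/seteqP; split => [x [n /=]|x Ekx]; last first.
        by exists k; rewrite //= leqnn addn0 leqnn.
      by rewrite addn0 -eqn_leq => /eqP <-.
    apply: lt_le_trans (muE k) _; rewrite lee_fin.
    have [_ + _] := HD _ (del0 k); move=> /le_trans; apply.
    by rewrite ler_piMr ?(ltW (del0 k))// invf_le1// ler1n.
  (* Peeling off the first set leaves two pieces of measure less than [del k.+1], whatever [l] is;
     their union then stays below [del k]. *)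
  have -> : U k l.+1 = E k `|` U k.+1 l.
    apply/seteqP; split => [x [n /= /andP[kn nkl] Enx]|x].
      move: kn; rewrite leq_eqVlt => /predU1P[->|kn]; first by left.
      by right; exists n; rewrite //= kn addSnnS.
    case=> [Ekx|[n /= /andP[kn nkl] Enx]].
      by exists k; rewrite //= leqnn leq_addr.
    by exists n; rewrite //= ltnW//= -addSnnS.
  have [_ _] := HD _ (del0 k); apply => //.
pose G k := \bigcup_(n >= k) E n.
have mG k : measurable (G k) by apply: bigcup_measurable => n _.
have muG : mu (G k) @[k --> \oo] --> 0%E.
  apply: muC => //; apply: cvge0_eps => [k|e e0].
    by apply: le_trans (ereal_sup_ubound _); [exact: nam_ge0 (mU k 0%N)|exists 0%N].
  apply: filterS (near_halfX_lt 1 e0) => k; rewrite mul1r => ke.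
  apply: ge_ereal_sup => _ [l _ <-]; apply: le_trans (ltW (muU l k)) _.
  by rewrite lee_fin (le_trans (del_half k))// ltW.
have Gni m n : (m <= n)%N -> G n `<=` G m.
  by move=> mn x [i /= ni Eix]; exists i => //=; exact: leq_trans ni.
have hG k x : ~ G k x -> cvgn (fun i => f_ (phi i) x) /\
    forall i, (k <= i)%N ->
      `|f_ (phi i) x - limn (fun i => f_ (phi i) x)| <= 2 * 2^-1 ^+ i.
  move=> nGx; apply: cvgn_halving_increments => i ki.
  by rewrite leNgt; apply/negP => Eix; apply: nGx; exists i.
(* A point outside [N0] avoids some [G k], so the subsequence converges there. On [N0] all functions
   are cut off to 0, which makes [f] an everywhere pointwise limit, hence measurable. *)
pose N0 := \bigcap_k G k.
have mN0 : measurable N0 by apply: bigcap_measurable => // k _.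
pose g i x := f_ (phi i) x * \1_(~` N0) x.
pose f x := limn (fun i => f_ (phi i) x) * \1_(~` N0) x.
have mg i : measurable_fun setT (g i).
  by apply: measurable_funM => //; apply: measurable_indic; exact: measurableC.
have mf : measurable_fun setT f.
  apply: (measurable_fun_cvg mg) => x _; rewrite /f /g indicE.
  have [N0x|] := pselect (N0 x).
    rewrite memNset; last by [].
    rewrite mulr0; under eq_fun do rewrite mulr0; exact: cvg_cst.
  move=> N0x; rewrite mem_set//.
  have [k nGkx] : exists k, ~ G k x.
    by apply/not_existsP => H; apply: N0x => k _; apply: contrapT.
  have [hcvg _] := hG _ _ nGkx.
  by rewrite mulr1; under eq_fun do rewrite mulr1.
have [F FE] := mfun_of_measurable mf; exists F => e e0.
exists G; split => // k.
(* Beyond [k] the tail estimate off [G k] applies, and beyond [n0] that tail is less than [e]. *)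
have [n0 _ n0e] := near_halfX_lt 2 e0; exists (maxn n0 k) => // i /=.
rewrite geq_max => /andP[n0i ki].
move=> x /=; rewrite FE /f; apply: contraPP => nGx.
have [_ /(_ _ ki)] := hG _ _ nGx.
rewrite indicE mem_set ?mulr1; last by move=> /(_ k I).
by move=> hle; apply/negP; rewrite -leNgt (le_trans hle)// ltW// n0e.
Qed.
End subsequence.

(** * Quasi-completeness for functions and for classes *)

Section completeness.
Context d (X : measurableType d) (R : realType).
Variables (mu : nonadditive_measure X R) (p q : R).
Hypotheses (p0 : 0 < p) (q0 : 0 < q) (mac : monotone_autocontinuous_below mu).
Local Notation F0 := {mfun X >-> R}.
Implicit Types f g : F0.

(** The constant sequence [f] converges to any equivalent [g] off a constant sequence of null sets,
    so Fatou's lemma gives one inequality, and symmetry the other. *)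
Lemma pqnorm_aeq f g : aeq mu f g -> pqnorm mu p q f = pqnorm mu p q g.
Proof.
have le_aeq f' g' : aeq mu f' g' -> (pqnorm mu p q g' <= pqnorm mu p q f')%E.
  move=> /asboolP fg; apply: (@pqnorm_fatou _ _ _ _ _ _ (fun=> f')) => //.
    move=> e e0; exists (fun=> [set x | e < `|f' x - g' x|]); split => //.
    - by move=> _; exact: (measurable_norm_gt (f' - g')).
    - by move=> *; exact: subset_refl.
    - by rewrite fg//; exact: cvg_cst.
    - by move=> k; exists 0%N => // n _; exact: subset_refl.
  by exists 0%N => // n _ /=.
move=> fg; apply/eqP; rewrite eq_le !le_aeq// aeq_sym//.
Qed.

Lemma Lpq_quasi_complete : property_C mu -> pgp mu ->
  quasi_complete (pqnorm mu p q) (Lpq mu p q).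
Proof.
move=> muC mupgp u _ u_bnd u_cauchy.
have [|phi phi_ge [f uf]] := @cauchy_measure_cvg_off _ _ _ _ u muC mupgp.
  move=> c e c0 e0; have [a a0 Ha] := pqnorm_chebyshev mu p0 q0 c0 e0.
  by have [N HN] := u_cauchy _ a0; exists N => m n Nm Nn; apply/Ha/HN.
exists f.
  apply: le_lt_trans u_bnd; apply: (pqnorm_fatou mac p0 q0 uf).
  by apply: nearW => n; apply: ereal_sup_ubound; exists (phi n).
apply: cvge0_eps => [n|e e0]; first exact: pqnorm_ge0.
have [N HN] := u_cauchy _ e0; exists N => // n /= Nn.
(* For fixed [n], the differences from [u n - f] are those between [f] and [u (phi i)], so the same
   exceptional sets serve. *)
apply: (@pqnorm_fatou _ _ _ _ _ _ (fun i => u n - u (phi i))) => //.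
  move=> a a0; have [G [mG Gni muG Gf]] := uf _ a0; exists G; split => // k.
  apply: filterS (Gf k) => i; apply: subset_trans => x /=.
  have -> : (u n - u (phi i)) x - (u n - f) x = f x - u (phi i) x.
    by rewrite -[LHS]/((u n x - u (phi i) x) - (u n x - f x)) opprB addrC addrA subrK.
  by rewrite distrC.
exists N => // i /= Ni; apply/ltW/HN => //.
exact: leq_trans Ni (phi_ge i).
Qed.

Local Open Scope quotient_scope.

Lemma class_pqnorm_pi f :
  class_pqnorm mac p q (\pi_(L0 mac) f) = pqnorm mu p q f.
Proof. by apply: pqnorm_aeq; apply/(L0_eqP mac); rewrite reprK. Qed.

Lemma class_pqnorm_piB f g :
  class_pqnorm mac p q (\pi_(L0 mac) f - \pi_(L0 mac) g) = pqnorm mu p q (f - g).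
Proof.
by rewrite -class_pqnorm_pi -(L0_pi_add mac) -(L0_pi_opp mac).
Qed.

(** Membership in [class_Lpq] provides only some representative of finite norm; invariance of the
    norm transfers this to [repr (u n)], and the result for functions applies. *)
Lemma class_Lpq_quasi_complete : property_C mu -> pgp mu ->
  quasi_complete (class_pqnorm mac p q) (class_Lpq mac p q).
Proof.
move=> muC mupgp u Su u_bnd u_cauchy.
have [n| | |f Lf uf] := @Lpq_quasi_complete muC mupgp (fun n => repr (u n)).
- have [g Lg <-] := Su n.
  by rewrite /Lpq/= -/(class_pqnorm mac p q _) class_pqnorm_pi.
- exact: u_bnd.
- move=> e e0; have [N HN] := u_cauchy _ e0.
  by exists N => m n Nm Nn; rewrite -class_pqnorm_piB !reprK; exact: HN.
exists (\pi_(L0 mac) f); first by exists f.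
have uE n : class_pqnorm mac p q (u n - \pi_(L0 mac) f) =
    pqnorm mu p q (repr (u n) - f).
  by rewrite -class_pqnorm_piB reprK.
by rewrite /cvg_for; under eq_fun do rewrite uE.
Qed.

End completeness.

Unset Implicit Arguments.

Theorem theorem6p6 (d : measure_display) (X : measurableType d) (R : realType)
    (mu : nonadditive_measure X R) (p q : R) (p0 : 0 < p) (q0 : 0 < q)
    (mac : monotone_autocontinuous_below mu) (muC : property_C mu) (mupgp : pgp mu) :
  quasi_complete (pqnorm mu p q) (Lpq mu p q) /\
  quasi_complete (class_pqnorm mac p q) (class_Lpq mac p q).
Proof.
by split; [exact: Lpq_quasi_complete|exact: class_Lpq_quasi_complete].
Qed.
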